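(* Let $\Omega\subset\mathbb{R}^2$ be a bounded polygonal domain with boundary $\Gamma$ having at most one non-convex corner, and let $f\in V'$, $u\in V_\Gamma'$. For $y\in L^2(\Omega)$ the following two formulations are equivalent: (i) (Very weak formulation) $(y,\Delta v)_\Omega=(u,\partial_n v)_\Gamma-(f,v)_\Omega$ for all $v\in V$. (ii) (Berggren's formulation) For all $\varphi\in L^2(\Omega)$, $$(y,\varphi)_\Omega=-(u,\zeta)_\Gamma+(f,v)_\Omega,$$ where, for given $\varphi$, the functions $v\in V$ and $\zeta\in V_\Gamma$ are determined by $$(\nabla v,\nabla\psi)_\Omega=(\varphi,\psi)_\Omega\quad\text{for all }\psi\in H^1_0(\Omega),$$ $$(\zeta,\chi)_\Gamma=(\nabla v,\nabla\chi)_\Omega-(\varphi,\chi)_\Omega\quad\text{for all }\chi\in H^1(\Omega)\setminus H^1_0(\Omega).$$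
   Context: $V:=\{v\in H^1_0(\Omega):\Delta v\in L^2(\Omega)\}$ (distributional Laplacian), with norm $\|v\|_V:=\|\Delta v\|_{L^2(\Omega)}$. For $v\in V$ the outward normal derivative $\partial_n v$ on $\Gamma$ is understood through the Green formula $(\partial_n v,\chi)_\Gamma=(\nabla v,\nabla\chi)_\Omega+(\Delta v,\chi)_\Omega$ for all $\chi\in H^1(\Omega)$; on the domains considered $\partial_n v\in L^2(\Gamma)$. $V_\Gamma:=\{\partial_n v:v\in V\}$, with norm $\|g\|_{V_\Gamma}:=\inf\{\|v\|_V:v\in V,\ \partial_n v=g\}$. Primes denote dual spaces. $(w,v)_G:=\int_G wv$ denotes the $L^2(G)$ scalar product or the corresponding duality pairing ($V'$–$V$ for $(f,v)_\Omega$, $V_\Gamma'$–$V_\Gamma$ for $(u,\zeta)_\Gamma$). *)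

(* Defs.v *)
From HB Require Import structures.
From mathcomp Require Import all_boot all_order all_algebra.
From mathcomp Require Import all_classical all_reals all_analysis.

Set Implicit Arguments.
Unset Strict Implicit.
Unset Printing Implicit Defensive.
Import Order.TTheory GRing.Theory Num.Theory.
Import numFieldNormedType.Exports.
Local Open Scope classical_set_scope.
Local Open Scope ring_scope.

(* Conventions.  The plane is R * R.  Elements of the various function spaces
   are represented by functions on the whole plane, of which only the values
   on Omega (resp. on the boundary) matter, up to null sets.  Weak gradients,
   distributional Laplacians, traces and normal derivatives are only determined
   almost everywhere, so each of them is a relation between representatives,
   and statements about "the" gradient, Laplacian, trace, ... of a function
   quantify over all its representatives. *)

Section Polygon.
Context {R : realType}.
Implicit Types (Omega : set (R * R)) (e : (R * R) * (R * R)).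

Definition edge_param e (s : R) : R * R :=
  (e.1.1 + s * (e.2.1 - e.1.1), e.1.2 + s * (e.2.2 - e.1.2)).

Definition edge_set e : set (R * R) := edge_param e @` `[0, 1].

(* Euclidean; the norm of the normed module R * R is the sup norm. *)
Definition edge_length e : R :=
  Num.sqrt ((e.2.1 - e.1.1) ^+ 2 + (e.2.2 - e.1.2) ^+ 2).

(* A closed polygon is the cyclic list of its vertices. *)
Definition loop_edges (p : seq (R * R)) : seq ((R * R) * (R * R)) :=
  zip p (rot 1 p).

Definition edges (loops : seq (seq (R * R))) : seq ((R * R) * (R * R)) :=
  flatten (map loop_edges loops).

(* The boundary of a polygonal domain consists of finitely many pairwise
   disjoint simple closed polygons.  As vertices are not repeated, two distinct
   edges share an endpoint, end of one and start of the other, only if they are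
   consecutive edges of the same loop; all other intersections are excluded.
   Since Omega is connected it lies on one side of each loop, so there are no
   slits. *)
Record polygonal_domain Omega (loops : seq (seq (R * R))) : Prop := {
  poly_nonempty : Omega !=set0 ;
  poly_open : open Omega ;
  poly_connected : connected Omega ;
  poly_bounded : bounded_set Omega ;
  poly_loop_size : forall p, p \in loops -> (3 <= size p)%N ;
  poly_uniq : uniq (flatten loops) ;
  poly_simple : forall e e', e \in edges loops -> e' \in edges loops ->
    e != e' -> forall x, edge_set e x -> edge_set e' x ->
    (x = e.2 /\ x = e'.1) \/ (x = e.1 /\ x = e'.2) ;
  poly_boundary : closure Omega `\` Omega =
    [set x | exists2 e, e \in edges loops & edge_set e x] }.

(* The interior angle at a vertex p is at most pi iff Omega is convex near p. *)
Definition convex_corner Omega (p : R * R) : Prop :=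
  exists2 r : R, 0 < r & convex_set (Omega `&` ball p r).

Definition at_most_one_nonconvex_corner Omega (loops : seq (seq (R * R))) :=
  forall p q, p \in flatten loops -> q \in flatten loops ->
    ~ convex_corner Omega p -> ~ convex_corner Omega q -> p = q.

End Polygon.

Section Spaces.
Context {R : realType}.
Variables (Omega : set (R * R)) (loops : seq (seq (R * R))).
Implicit Types (v w chi phi l : R * R -> R) (gv gw : R * R -> R * R)
  (g t : R * R -> R).

Definition area : {measure set (measurableTypeR R * measurableTypeR R) -> \bar R} :=
  (lebesgue_measure \x lebesgue_measure)%E.

Definition L2 : set (R * R -> R) :=
  [set w : R * R -> R | measurable_fun Omega w /\
           area.-integrable Omega (fun x => (w x ^+ 2)%:E)].

Definition ip v w : R := \int[area]_(x in Omega) (v x * w x).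

Definition ip_grad gv gw : R :=
  ip (fun x => (gv x).1) (fun x => (gw x).1) +
  ip (fun x => (gv x).2) (fun x => (gw x).2).

(* Functions on the boundary, with respect to arc length. *)
Definition L2_bd : set (R * R -> R) :=
  [set g : R * R -> R | forall e, e \in edges loops ->
     measurable_fun (`[0, 1] : set R) (g \o edge_param e) /\
     lebesgue_measure.-integrable `[0, 1]
       (fun s => (g (edge_param e s) ^+ 2)%:E)].

Definition ip_bd g t : R :=
  \sum_(e <- edges loops) edge_length e *
    \int[lebesgue_measure]_(s in `[0, 1])
      (g (edge_param e s) * t (edge_param e s)).

Definition d1 phi : R * R -> R := fun x => 'D_((1, 0) : R * R) phi x.
Definition d2 phi : R * R -> R := fun x => 'D_((0, 1) : R * R) phi x.
Definition grad phi : R * R -> R * R := fun x => (d1 phi x, d2 phi x).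
Definition laplace phi : R * R -> R := fun x => d1 (d1 phi) x + d2 (d2 phi) x.

(* C^oo on the whole plane: all iterated partial derivatives exist and are
   continuous; s lists the directions of differentiation. *)
Definition smooth phi : Prop :=
  forall s : seq bool,
    let psi := foldr (fun b => if b then d1 else d2) phi s in
    continuous psi /\
    forall x, derivable psi x ((1, 0) : R * R) /\
              derivable psi x ((0, 1) : R * R).

Definition test_fun : set (R * R -> R) :=
  [set phi | smooth phi /\
     exists K : set (R * R), [/\ compact K, K `<=` Omega &
       forall x, ~ K x -> phi x = 0]].

Definition is_weak_grad w gw : Prop :=
  [/\ L2 (fun x => (gw x).1), L2 (fun x => (gw x).2) &
      forall phi, test_fun phi ->
        ip w (d1 phi) = - ip (fun x => (gw x).1) phi /\
        ip w (d2 phi) = - ip (fun x => (gw x).2) phi].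

Definition is_laplacian v l : Prop :=
  L2 l /\ forall phi, test_fun phi -> ip v (laplace phi) = ip l phi.

Definition H1 : set (R * R -> R) :=
  [set w | L2 w /\ exists gw, is_weak_grad w gw].

(* Convergence in H^1(Omega) of a sequence of smooth functions. *)
Definition H1_cvg (phi : nat -> R * R -> R) w : Prop :=
  exists2 gw, is_weak_grad w gw &
    (fun n => ip (phi n \- w) (phi n \- w) +
              ip_grad (fun x => grad (phi n) x - gw x)
                      (fun x => grad (phi n) x - gw x)) @ \oo --> (0 : R).

Definition H10 : set (R * R -> R) :=
  [set w | H1 w /\
     exists2 phi : nat -> R * R -> R, (forall n, test_fun (phi n)) &
       H1_cvg phi w].

(* The trace operator H^1(Omega) -> L^2(bd Omega) is the continuous extension
   of the restriction to the boundary of functions smooth up to the boundary. *)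
Definition is_trace w t : Prop :=
  [/\ H1 w, L2_bd t &
    exists2 phi : nat -> R * R -> R, (forall n, smooth (phi n)) &
      H1_cvg phi w /\
      (fun n => ip_bd (phi n \- t) (phi n \- t)) @ \oo --> (0 : R)].

Definition V : set (R * R -> R) :=
  [set v | H10 v /\ exists l, is_laplacian v l].

(* is_laplacian v determines l almost everywhere, so for v in V the set below
   is the singleton of the L^2-norm of the Laplacian of v. *)
Definition normV v : R :=
  inf [set Num.sqrt (ip l l) | l in is_laplacian v].

(* Green's formula, l being a representative of the Laplacian of v; (g, chi) on
   the boundary involves the trace of chi. *)
Definition is_normal_derivative v l g : Prop :=
  L2_bd g /\
  forall gv chi gchi t,
    is_weak_grad v gv -> H1 chi -> is_weak_grad chi gchi -> is_trace chi t ->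
    ip_bd g t = ip_grad gv gchi + ip l chi.

Definition VGamma : set (R * R -> R) :=
  [set g | exists v l,
     [/\ V v, is_laplacian v l & is_normal_derivative v l g]].

Definition normVGamma g : R :=
  inf [set normV v | v in [set v | V v /\
     exists l, is_laplacian v l /\ is_normal_derivative v l g]].

(* The functional F on the space S normed by N; only the values of F on S are
   relevant, and the bound makes F v independent of the representative of v. *)
Definition in_dual (S : set (R * R -> R)) (N : (R * R -> R) -> R)
    (F : (R * R -> R) -> R) : Prop :=
  (forall (a : R) v w, S v -> S w ->
     F (fun x => a * v x + w x) = a * F v + F w) /\
  exists C : R, forall v, S v -> `|F v| <= C * N v.

(* On a polygonal domain every v in V has a normal derivative in L^2 of the
   boundary, so the following quantifies over all v in V. *)
Definition very_weak_formulation (f u : (R * R -> R) -> R) (y : R * R -> R) :=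
  forall v l g, V v -> is_laplacian v l -> is_normal_derivative v l g ->
    ip y l = u g - f v.

(* v solves the Dirichlet problem with right-hand side phi. *)
Definition berggren_state phi v : Prop :=
  forall gv psi gpsi, is_weak_grad v gv -> H10 psi -> is_weak_grad psi gpsi ->
    ip_grad gv gpsi = ip phi psi.

Definition berggren_flux phi v zeta : Prop :=
  forall gv chi gchi t,
    is_weak_grad v gv -> (H1 `\` H10) chi -> is_weak_grad chi gchi ->
    is_trace chi t ->
    ip_bd zeta t = ip_grad gv gchi - ip phi chi.

(* v and zeta are the unique solutions of the two problems determined by phi. *)
Definition berggren_formulation (f u : (R * R -> R) -> R) (y : R * R -> R) :=
  forall phi v zeta, L2 phi -> V v -> VGamma zeta ->
    berggren_state phi v -> berggren_flux phi v zeta ->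
    ip y phi = - u zeta + f v.

End Spaces.

(* Main.v *)
(* Both formulations say the same thing about phi = - Delta v once two facts are
   known.  Testing the Dirichlet problem with C_c^oo functions shows that its
   solution v satisfies Delta v = - phi, and the flux equation is Green's formula
   for zeta, but only for chi outside H^1_0.  For chi in H^1_0 one applies it to
   chi + 1 and chi + 2, which are not in H^1_0, and subtracts.  That chi + c is
   not in H^1_0 follows from int w = - int x_1 d_1 w on H^1_0: otherwise c would
   have integral 0.  Conversely a function of H^1_0 has trace 0, so that Green's
   formula for the normal derivative, tested with H^1_0, is the Dirichlet
   problem. *)

Require Import Defs.
From mathcomp Require Import all_boot all_order all_algebra.
From mathcomp Require Import all_classical all_reals all_analysis.
From mathcomp Require Import measurable_realfun ring lra.

Set Implicit Arguments.
Unset Strict Implicit.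
Unset Printing Implicit Defensive.
Import Order.TTheory GRing.Theory Num.Theory.
Import numFieldNormedType.Exports.
Local Open Scope classical_set_scope.
Local Open Scope ring_scope.

(** * Measurability in the plane, and the integral of a derivative on the line *)

(** The product sigma-algebra contains the rectangles, and an open set is the countable union of the
    squares with rational centre and radius 1/(n+1) that it contains. *)
Lemma open_measurable_prod (R : realType) (A : set (R * R)) :
  open A -> measurable A.
Proof.
move=> oA.
pose B (k : rat * rat * nat) : set (R * R) :=
  ball (ratr k.1.1 : R) k.2.+1%:R^-1 `*` ball (ratr k.1.2 : R) k.2.+1%:R^-1.
have -> : A = \bigcup_(k in [set k | B k `<=` A]) B k.
  apply/seteqP; split => [x Ax|x [k /= kA /kA//]].
  have /nbhs_ballP[e /= e0 xeA] := open_nbhs_nbhs (conj oA Ax).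
  have e20 : 0 < e / 2 by rewrite divr_gt0.
  have [n _ /(_ n (leqnn n)) /= ne] := near_infty_natSinv_lt (PosNum e20).
  have pn : 0 < n.+1%:R^-1 :> R by rewrite invr_gt0.
  have dq (z : R) : exists q : rat, ball z n.+1%:R^-1 (ratr q : R).
    have zz : ball z n.+1%:R^-1 z by exact: ballxx.
    have [|r [zr [q _ qr]]] := @dense_rat R _ (ex_intro _ z zz); last first.
      by exists q; rewrite qr.
    exact: ball_open.
  have [q1 q1P] := dq x.1; have [q2 q2P] := dq x.2.
  exists (q1, q2, n) => /=; last by split; apply: ball_sym.
  (* Radii below [e / 2] keep a square whose centre is near [x] inside the ball of radius [e] around
     [x]. *)
  have close (a b q : R) : ball a n.+1%:R^-1 q -> ball q n.+1%:R^-1 b ->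
      ball a e b.
    move=> aq /(ball_triangle aq); apply: le_ball.
    by rewrite (splitr e) lerD// ltW.
  move=> z [z1 z2]; apply: xeA.
  by split; [exact: close q1P z1|exact: close q2P z2].
rewrite bigcup_mkcond.
apply: countable_bigcupT_measurable => // k; case: ifPn => // _.
by apply: measurableX; exact: measurable_ball.
Qed.

Lemma continuous_measurable_prod (R : realType) (D : set (R * R))
    (f : R * R -> R) :
  measurable D -> continuous f -> measurable_fun D f.
Proof.
move=> mD /continuousP cf; apply: (measurability _ (RGenOpens.measurableE R)).
move=> _ [_ [a [b ->] <-]]; apply: measurableI => //.
by apply: (@open_measurable_prod R); apply: cf; exact: interval_open.
Qed.

(** The fundamental theorem of calculus on an interval at whose endpoints [g] vanishes. *)
Lemma integral_derive_compact_support (R : realType) (g : R -> R) (M : R) :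
  (forall x, derivable g x 1) -> continuous (derive1 g) ->
  (forall x, M <= `|x| -> g x = 0) ->
  (\int[lebesgue_measure]_x (derive1 g x)%:E = 0)%E.
Proof.
move=> dg cg' g0.
(* The sign of [M] is unknown; with this [N] the interval has positive length, and [g] vanishes at
   its endpoints and outside it. *)
pose N : R := `|M| + 1.
have N0 : 0 < N by rewrite ltr_pwDr.
have MN : M < N by rewrite ltr_pwDr// ler_norm.
have g'0 (x : R) : ~ (`[- N, N]%classic : set R) x -> derive1 g x = 0.
  move=> /= xN.
  rewrite derive1E (@near_eq_derive _ _ _ _ (cst 0)) ?derive_cst//.
  have xI : (~` `[- N, N]%classic : set R) x by [].
  have oI : open (~` `[- N, N]%classic : set R).
    by apply: closed_openC; exact: interval_closed.
  have := open_nbhs_nbhs (conj oI xI).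
  apply: filterS => z /= /negP; rewrite in_itv/= -ler_norml -ltNge => zN.
  by rewrite g0// ltW// (lt_trans MN).
have -> : (\int[lebesgue_measure]_x (derive1 g x)%:E =
   \int[lebesgue_measure]_(x in `[(- N)%R, N]) (derive1 g x)%:E)%E.
  rewrite [RHS]integral_mkcond; apply: eq_integral => x _.
  rewrite patchE; case: ifPn => //.
  by rewrite notin_setE => /g'0 ->.
have cg : continuous g.
  by move=> x; apply/differentiable_continuous/derivable1_diffP.
rewrite (@continuous_FTC2 _ _ g).
- by rewrite !g0 ?subee// ?normrN ger0_norm// ltW.
- lra.
- exact: continuous_subspaceT.
- split => //.
  + exact/cvg_at_right_filter/cg.
  + exact/cvg_at_left_filter/cg.
- by [].
Qed.

(** * Partial derivatives along lines, and Fubini *)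

Section Partial.
Context {R : realType}.
Implicit Types (f h phi : R * R -> R) (A K : set (R * R)).

(* d1 is convertible to [pd true], and d2 to [pd false]. *)
Definition dir (b : bool) : R * R := if b then (1, 0) else (0, 1).

Definition pd (b : bool) phi : R * R -> R := fun x => 'D_(dir b) phi x.

Lemma bounded_set_norm_lt A : bounded_set A ->
  exists2 M : R, 0 < M & forall x, A x -> `|x| < M.
Proof.
move=> [M [_ AM]]; exists (`|M| + 2); first by rewrite ltr_wpDl.
move=> x Ax; apply: le_lt_trans (AM (`|M| + 1) _ x Ax) _.
  by rewrite ltr_pwDr// ler_norm.
by rewrite ltrD2l ltr1n.
Qed.

Lemma area_bounded A : measurable A -> bounded_set A -> (area A < +oo)%E.
Proof.
move=> mA /bounded_set_norm_lt[M M0 AM].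
pose I : set R := `[- M, M]%classic.
have mI : measurable I by exact: measurable_itv.
apply: (@le_lt_trans _ _ (area (I `*` I))).
  apply: le_measure; rewrite ?inE//; first exact: measurableX.
  move=> x /AM; rewrite prod_normE gt_max => /andP[x1 x2].
  by split; rewrite /I/= in_itv/= -ler_norml ltW.
have -> : area (I `*` I) = (lebesgue_measure I * lebesgue_measure I)%E.
  exact: product_measure1E.
rewrite lte_mul_pinfty// lebesgue_measure_itv/=; case: ifPn => // _.
by rewrite -EFinB ?lee_fin// ?ltry//; lra.
Qed.

(** [A] need not be closed, so compactness is taken from a closed square that contains it. *)
Lemma continuous_bounded A f : bounded_set A -> continuous f ->
  exists2 C : R, 0 < C & forall x, A x -> `|f x| < C.
Proof.
move=> /bounded_set_norm_lt[M M0 AM] cf.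
pose I : set R := `[- M, M]%classic.
have cI : compact (I `*` I) by apply: compact_setX; exact: segment_compact.
have /compact_bounded : compact (f @` (I `*` I)).
  by apply: continuous_compact => //; exact: continuous_subspaceT.
move=> [C [_ CP]]; exists (`|C| + 2); first by rewrite ltr_wpDl.
move=> x /AM; rewrite prod_normE gt_max => /andP[x1 x2].
apply: le_lt_trans (CP (`|C| + 1) _ (f x) _) _; last by rewrite ltrD2l ltr1n.
- by rewrite ltr_pwDr// ler_norm.
- by exists x => //; split; rewrite /I/= in_itv/= -ler_norml ltW.
Qed.

Lemma continuous_integrable A f : measurable A -> bounded_set A ->
  continuous f -> area.-integrable A (EFin \o f).
Proof.
move=> mA bA cf; apply: measurable_bounded_integrable => //.
- exact: area_bounded.
- exact: continuous_measurable_prod.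
- have [C C0 fC] := continuous_bounded bA cf.
  exists C; split; first exact: num_real.
  by move=> D CD x Ax; rewrite /= ltW// (lt_trans (fC x Ax)).
Qed.

(** A compact set is closed, so [h] vanishes on a whole neighbourhood of [x]. *)
Lemma pd_outside K b h x : compact K -> (forall x, ~ K x -> h x = 0) ->
  ~ K x -> pd b h x = 0.
Proof.
move=> cK h0 nKx; rewrite /pd (@near_eq_derive _ _ _ _ (cst 0)) ?derive_cst//.
have oK : open (~` K).
  by apply: closed_openC; apply: compact_closed => //; exact: norm_hausdorff.
by apply: filterS (open_nbhs_nbhs (conj oK nKx)) => z /h0.
Qed.

Definition slice (b : bool) h (t s : R) : R := if b then h (s, t) else h (t, s).

(** The two difference quotients are the same function of the increment, so derivability and
    derivatives transfer at once. *)
Lemma slice_quotient b h t s :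
  (fun k : R => k^-1 *: ((slice b h t \o shift s) (k *: 1) - slice b h t s)) =
  (let x := if b then (s, t) else (t, s) in
   fun k : R => k^-1 *: ((h \o shift x) (k *: dir b) - h x)).
Proof.
apply/funext => k; rewrite /slice /dir; case: b => /=.
- by congr (_ *: (h (_ , _) - _)); rewrite /= scaler0 add0r.
- by congr (_ *: (h (_ , _) - _)); rewrite /= scaler0 add0r.
Qed.

Lemma derivable_slice b h t s :
  derivable h (if b then (s, t) else (t, s)) (dir b) ->
  derivable (slice b h t) s 1.
Proof. by rewrite /derivable slice_quotient. Qed.

Lemma derive1_slice b h t s :
  derive1 (slice b h t) s = slice b (pd b h) t s.
Proof.
by rewrite derive1E /derive slice_quotient /slice /pd /derive; case: b.
Qed.

Lemma continuous_slice b f t : continuous f -> continuous (slice b f t).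
Proof.
move=> cf s; rewrite /slice; case: b.
- have st : (z, t) @[z --> s] --> (s, t) by exact: cvg_pair cvg_id (cvg_cst _).
  exact: (cvg_comp _ _ st (cf (s, t))).
- have st : (t, z) @[z --> s] --> (t, s) by exact: cvg_pair (cvg_cst _) cvg_id.
  exact: (cvg_comp _ _ st (cf (t, s))).
Qed.

(** By Fubini, integrating first in the direction of differentiation: each inner integral is that of
    the derivative of a compactly supported function of one variable. *)
Lemma Rintegral_pd A K b h : measurable A -> bounded_set A ->
  compact K -> K `<=` A -> (forall x, ~ K x -> h x = 0) ->
  (forall x, derivable h x (dir b)) -> continuous (pd b h) ->
  \int[area]_(x in A) pd b h x = 0.
Proof.
move=> mA bA cK KA h0 dh cdh.
(* The integrand vanishes off [K], hence off [A], and can be integrated over the whole plane. *)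
have hA : (EFin \o pd b h) \_ A = EFin \o pd b h.
  apply/funext => x; rewrite patchE; case: ifPn => //.
  rewrite notin_setE => nAx /=; rewrite (pd_outside b cK h0)// => Kx.
  exact/nAx/KA.
have ih : area.-integrable setT (EFin \o pd b h).
  rewrite -hA; have := @integrable_mkcond _ _ _ area A (EFin \o pd b h) mA.
  by case=> + _; apply; exact: continuous_integrable.
have [M M0 AM] := bounded_set_norm_lt bA.
have slice0 t : (\int[lebesgue_measure]_s (slice b (pd b h) t s)%:E = 0)%E.
  under eq_integral do rewrite -derive1_slice.
  apply: (@integral_derive_compact_support _ _ M).
  - by move=> s; apply: derivable_slice; exact: dh.
  - rewrite (_ : derive1 _ = slice b (pd b h) t); first exact: continuous_slice.
    by apply/funext => s; rewrite derive1_slice.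
  - move=> s sM; rewrite /slice.
    by case: b {dh cdh hA ih}; apply: h0 => /KA/AM; rewrite prod_normE gt_max/=;
      move=> /andP[]; rewrite !ltNge sM.
rewrite /Rintegral integral_mkcond (_ : _ \_ A = EFin \o pd b h)//.
(* [b] decides which of the two iterated integrals has the slices as its inner integrals. *)
case: b dh cdh hA ih slice0 => dh cdh hA ih slice0.
- rewrite -(integral21_prod_meas1 ih) (_ : fubini_G _ _ = cst 0%E) ?integral0//.
  by apply/funext => t; exact: slice0.
- rewrite -(integral12_prod_meas1 ih) (_ : fubini_F _ _ = cst 0%E) ?integral0//.
  by apply/funext => t; exact: slice0.
Qed.

End Partial.

(** * Square integrable functions and Cauchy-Schwarz *)

Section InnerProduct.
Context d (T : measurableType d) {R : realType}.
Variable (mu : {measure set T -> \bar R}).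
Variable (D : set T).
Hypothesis mD : measurable D.
Implicit Types f g h : T -> R.

(** The measure is arbitrary so that the results apply to [L2] on the domain and, edge by edge, to
    [L2_bd]; both unfold to this condition, and [ip] unfolds to [inner]. *)
Definition square_integrable f := measurable_fun D f /\
  mu.-integrable D (fun x => (f x ^+ 2)%:E).

Definition inner f g : R := \int[mu]_(x in D) (f x * g x).

(** Domination of |fg| by f^2 + g^2. *)
Lemma square_integrable_mul f g : square_integrable f -> square_integrable g ->
  mu.-integrable D (EFin \o (fun x => f x * g x)).
Proof.
move=> [mf f2] [mg g2].
have fg2 := integrableD mD f2 g2.
apply: le_integrable fg2 => //.
  by apply/measurable_EFinP; exact: measurable_funM.
move=> x _ /=; rewrite lee_fin normrM.
rewrite [leRHS]ger0_norm ?addr_ge0 ?sqr_ge0//.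
rewrite -(real_normK (num_real (f x))) -(real_normK (num_real (g x))).
have := normr_ge0 (f x); have := normr_ge0 (g x).
move: (`|f x|) (`|g x|) => a b a0 b0; nra.
Qed.

Lemma square_integrable_lin (a : R) f g :
  square_integrable f -> square_integrable g ->
  square_integrable (fun x => a * f x + g x).
Proof.
move=> fL gL; have fg := square_integrable_mul fL gL.
case: fL gL => [mf f2] [mg g2]; split.
  by apply: measurable_funD => //; exact: measurable_funM.
have := integrableD mD (integrableZl mD (a ^+ 2) f2)
  (integrableD mD (integrableZl mD (2 * a) fg) g2).
apply: eq_integrable => // x _ /=.
by rewrite -!EFinM -!EFinD; congr EFin; ring.
Qed.

Lemma inner_sym f g : inner f g = inner g f.
Proof. by apply: eq_Rintegral => x _; rewrite mulrC. Qed.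

Lemma inner_lin (a : R) f g h : square_integrable f -> square_integrable g ->
  square_integrable h ->
  inner (fun x => a * f x + g x) h = a * inner f h + inner g h.
Proof.
move=> fL gL hL.
have fh := square_integrable_mul fL hL; have gh := square_integrable_mul gL hL.
rewrite /inner -RintegralZl// -RintegralD//.
  by apply: eq_Rintegral => x _; ring.
by have := integrableZl mD a fh.
Qed.

Lemma inner_ge0 f : 0 <= inner f f.
Proof. by apply: Rintegral_ge0 => x _; rewrite -expr2 sqr_ge0. Qed.

(** The quadratic polynomial [a] -> |a f + g|^2 takes no negative value. *)
Lemma inner_CS f g : square_integrable f -> square_integrable g ->
  inner f g ^+ 2 <= inner f f * inner g g.
Proof.
move=> fL gL.
have quad (a : R) : 0 <= a ^+ 2 * inner f f + 2 * a * inner f g + inner g g.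
  have hL := square_integrable_lin a fL gL.
  have := inner_ge0 (fun x => a * f x + g x).
  rewrite inner_lin// (inner_sym f) (inner_sym g) !inner_lin// (inner_sym g f).
  by move/le_trans; apply; rewrite le_eqVlt; apply/orP; left; apply/eqP; ring.
move: quad (inner_ge0 f).
move: (inner f f) (inner f g) (inner g g) => A B C quad.
rewrite le_eqVlt => /predU1P[A0|A0].
  have B0 : B = 0.
    apply/eqP; apply: contraT => B0.
    (* With [A] zero the polynomial is affine, and this [a] gives it the value -1. *)
    have := quad (- (C + 1) / (2 * B)); rewrite -A0 mulr0 add0r.
    have -> : 2 * (- (C + 1) / (2 * B)) * B = - (C + 1).
      by field; rewrite B0.
    lra.
  by rewrite B0 expr0n/= -A0 mul0r.
(* The minimum point of the polynomial. *)
have := quad (- B / A).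
have -> : (- B / A) ^+ 2 * A + 2 * (- B / A) * B + C = C - B ^+ 2 / A.
  by field; rewrite gt_eqF.
by rewrite subr_ge0 ler_pdivrMr// mulrC.
Qed.

(** Norm convergence implies weak convergence, by Cauchy-Schwarz applied to [f_ n - f] and [g]. *)
Lemma cvg_inner (f_ : nat -> T -> R) f g :
  (forall n, square_integrable (f_ n)) -> square_integrable f ->
  square_integrable g ->
  (fun n => inner (fun x => f_ n x - f x) (fun x => f_ n x - f x)) @ \oo -->
    (0 : R) ->
  (fun n => inner (f_ n) g) @ \oo --> inner f g.
Proof.
move=> f_L fL gL f_f.
have fE n : (fun x => f_ n x - f x) = (fun x => -1 * f x + f_ n x).
  by apply/funext => x; rewrite mulN1r addrC.
rewrite -[in X in _ --> X](add0r (inner f g)).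
have -> : (fun n => inner (f_ n) g) =
    (fun n => inner (fun x => f_ n x - f x) g + inner f g).
  by apply/funext => n; rewrite fE inner_lin//; ring.
apply: cvgD; last exact: cvg_cst.
apply: norm_cvg0; apply: (@squeeze_cvgr _ _ _ _ (cst 0) (fun n => Num.sqrt
  (inner (fun x => f_ n x - f x) (fun x => f_ n x - f x) * inner g g))).
- apply: nearW => n; rewrite normr_ge0/= -sqrtr_sqr ler_wsqrtr// inner_CS// fE.
  exact: square_integrable_lin.
- exact: cvg_cst.
- rewrite -[X in _ --> X]sqrtr0 -(mul0r (inner g g)).
  apply: continuous_cvg; first exact: sqrt_continuous.
  by apply: cvgM => //; exact: cvg_cst.
Qed.

End InnerProduct.

(** * Smooth functions and the addition of constants *)

Section Smooth.
Context {R : realType}.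
Implicit Types (phi : R * R -> R).

(** [foldr] applies the last direction first, so peeling the list at its end leaves iterated
    partials of [pd b phi]. *)
Lemma foldr_pd_rcons phi s b :
  foldr (fun b => if b then d1 else d2) phi (rcons s b) =
  foldr (fun b => if b then d1 else d2) (pd b phi) s.
Proof. by rewrite -cats1 foldr_cat; case: b. Qed.

Lemma smooth_continuous phi : smooth phi -> continuous phi.
Proof. by move=> /(_ [::])[]. Qed.

Lemma smooth_derivable b phi x : smooth phi -> derivable phi x (dir b).
Proof.
move=> sphi; have [_ dphi] := sphi [::].
by have [dphi1 dphi2] := dphi x; case: b; [exact: dphi1|exact: dphi2].
Qed.

Lemma smooth_pd b phi : smooth phi -> smooth (pd b phi).
Proof. by move=> sphi s; rewrite -foldr_pd_rcons; exact: sphi. Qed.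

(** An equality of quotients rather than of limits, so that derivatives can be rewritten without any
    derivability assumption. *)
Lemma quotient_addc phi (c : R) (x v : R * R) :
  (fun k : R => k^-1 *:
     (((fun x => phi x + c) \o shift x) (k *: v) - (phi x + c))) =
  (fun k : R => k^-1 *: ((phi \o shift x) (k *: v) - phi x)).
Proof.
by apply/funext => k /=; congr (_ *: _); rewrite opprD addrACA subrr addr0.
Qed.

Lemma pd_addc b phi (c : R) : pd b (fun x => phi x + c) = pd b phi.
Proof. by apply/funext => x; rewrite /pd /derive quotient_addc. Qed.

Lemma grad_addc phi (c : R) : grad (fun x => phi x + c) = grad phi.
Proof.
apply/funext => x; congr pair.
- exact: (congr1 (fun f => f x) (pd_addc true phi c)).
- exact: (congr1 (fun f => f x) (pd_addc false phi c)).
Qed.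

Lemma derivable_addc phi (c : R) x v :
  derivable phi x v -> derivable (fun x => phi x + c) x v.
Proof. by rewrite /derivable quotient_addc. Qed.

Lemma smooth_addc phi (c : R) : smooth phi -> smooth (fun x => phi x + c).
Proof.
(* Only the empty list of derivatives sees the constant; the first differentiation removes it. *)
move=> sphi s; case/lastP: s => [|s b]; last first.
  by rewrite foldr_pd_rcons pd_addc -foldr_pd_rcons; exact: sphi.
split=> [x|x]; first by apply: cvgD; [exact: smooth_continuous|exact: cvg_cst].
split; apply: derivable_addc.
- exact: (@smooth_derivable true).
- exact: (@smooth_derivable false).
Qed.

Lemma smooth_cst (c : R) : smooth (fun=> c).
Proof.
rewrite (_ : (fun=> c) = (fun x => (fun=> 0) x + c)); last first.
  by apply/funext => x; rewrite add0r.
apply: smooth_addc => s.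
have -> : foldr (fun b => if b then d1 else d2) (fun=> 0) s =
    cst 0 :> (R * R -> R).
  elim: s => //= b s ->.
  by apply/funext => x; case: b; rewrite /d1 /d2 derive_cst.
by split => [x|x]; [exact: cvg_cst|split].
Qed.

End Smooth.

(** * Integration by parts, weak gradients and H^1 on a bounded open set *)

Section Domain.
Context {R : realType}.
Variable Omega : set (R * R).
Hypotheses (oO : open Omega) (bO : bounded_set Omega).
Implicit Types (f w v phi psi : R * R -> R) (gw : R * R -> R * R).

Let mO : measurable Omega := open_measurable_prod oO.

Lemma L2_continuous f : continuous f -> L2 Omega f.
Proof.
move=> cf; split; first exact: continuous_measurable_prod.
have := continuous_integrable mO bO (f := fun x => f x ^+ 2); apply.
by move=> x; apply: cvgM; exact: cf.
Qed.

Lemma L2_lin (a : R) f w : L2 Omega f -> L2 Omega w ->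
  L2 Omega (fun x => a * f x + w x).
Proof. exact: (square_integrable_lin (mu := area) mO). Qed.

Lemma ip_sym f w : ip Omega f w = ip Omega w f.
Proof. exact: inner_sym. Qed.

Lemma ip_lin (a : R) f v w : L2 Omega f -> L2 Omega v -> L2 Omega w ->
  ip Omega (fun x => a * f x + v x) w = a * ip Omega f w + ip Omega v w.
Proof. exact: (inner_lin (mu := area) mO). Qed.

Lemma ip_CS f w : L2 Omega f -> L2 Omega w ->
  ip Omega f w ^+ 2 <= ip Omega f f * ip Omega w w.
Proof. exact: (inner_CS (mu := area) mO). Qed.

Lemma cvg_ip (f_ : nat -> R * R -> R) f w :
  (forall n, L2 Omega (f_ n)) -> L2 Omega f -> L2 Omega w ->
  (fun n => ip Omega (fun x => f_ n x - f x) (fun x => f_ n x - f x)) @ \oo -->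
    (0 : R) ->
  (fun n => ip Omega (f_ n) w) @ \oo --> ip Omega f w.
Proof. exact: (cvg_inner (mu := area) mO). Qed.

Lemma L2_opp f : L2 Omega f -> L2 Omega (fun x => - f x).
Proof.
(* Writing -f as (-2) f + f puts it in the form [a * f + w] with [f] alone. *)
move=> fL; have := L2_lin (- 2) fL fL.
by congr (L2 Omega _); apply/funext => x; ring.
Qed.

Lemma ip_opp f w : L2 Omega f -> L2 Omega w ->
  ip Omega (fun x => - f x) w = - ip Omega f w.
Proof.
move=> fL wL; have -> : (fun x => - f x) = (fun x => - 2 * f x + f x).
  by apply/funext => x; ring.
by rewrite ip_lin//; ring.
Qed.

Lemma ip_addcl f w (c : R) : L2 Omega f -> L2 Omega w ->
  ip Omega (fun x => f x + c) w = ip Omega f w + c * ip Omega (fun=> 1) w.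
Proof.
move=> fL wL; have -> : (fun x => f x + c) = (fun x => c * (fun=> 1) x + f x).
  by apply/funext => x; rewrite mulr1 addrC.
rewrite [RHS]addrC; apply: ip_lin => //.
by apply: L2_continuous => x; exact: cvg_cst.
Qed.

Lemma test_fun_pd b phi : test_fun Omega phi -> test_fun Omega (pd b phi).
Proof.
move=> [sphi [K [cK KO phi0]]]; split; first exact: smooth_pd.
by exists K; split => // x; exact: pd_outside.
Qed.

Lemma test_fun_L2 phi : test_fun Omega phi -> L2 Omega phi.
Proof. by move=> [/smooth_continuous/L2_continuous]. Qed.

(** The product rule: [f * phi] inherits the compact support of [phi], so its partial derivative has
    integral 0. *)
Lemma ip_pd b f phi : continuous f -> (forall x, derivable f x (dir b)) ->
  continuous (pd b f) -> test_fun Omega phi ->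
  ip Omega f (pd b phi) = - ip Omega (pd b f) phi.
Proof.
move=> cf df cdf tphi; have [sphi [K [cK KO phi0]]] := tphi.
have dphi x : derivable phi x (dir b) by exact: smooth_derivable.
have cphi := smooth_continuous sphi.
have cdphi := smooth_continuous (smooth_pd b sphi).
have pdM : pd b (f * phi) = (fun x => f x * pd b phi x + pd b f x * phi x).
  by apply/funext => x; rewrite /pd deriveM// [X in _ + X]mulrC.
have : \int[area]_(x in Omega) pd b (f * phi) x = 0.
  apply: (Rintegral_pd mO bO cK KO).
  - by move=> x /phi0 h; rewrite /GRing.mul/= h mulr0.
  - by move=> x; exact: derivableM.
  - rewrite pdM => x; apply: cvgD; apply: cvgM.
    + exact: cf.
    + exact: cdphi.
    + exact: cdf.
    + exact: cphi.
rewrite pdM RintegralD//.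
- by move=> /eqP; rewrite addr_eq0 => /eqP.
- apply: (square_integrable_mul (mu := area) mO); first exact: L2_continuous.
  exact: L2_continuous.
- apply: (square_integrable_mul (mu := area) mO); first exact: L2_continuous.
  exact: L2_continuous.
Qed.

(** This is why adding a constant to a function preserves its weak gradients. *)
Lemma ip_cst_pd b (c : R) phi : test_fun Omega phi ->
  ip Omega (fun=> c) (pd b phi) = 0.
Proof.
have s1 := smooth_cst c.
move=> tphi; rewrite ip_pd//.
- have -> : pd b (fun=> c) = (fun=> 0).
    by apply/funext => x; rewrite /pd derive_cst.
  rewrite /ip (@eq_Rintegral _ _ _ _ _ (fun=> 0)); last first.
    by move=> x _; rewrite mul0r.
  by rewrite Rintegral_cst// mul0r oppr0.
- exact: smooth_continuous.
- exact/smooth_continuous/smooth_pd.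
Qed.

Lemma is_weak_grad_smooth f : smooth f -> is_weak_grad Omega f (grad f).
Proof.
move=> sf; have cf := smooth_continuous sf.
have cdf b := smooth_continuous (smooth_pd b sf).
have dbf b x : derivable f x (dir b) by exact: smooth_derivable.
split; [exact/L2_continuous/(cdf true)|exact/L2_continuous/(cdf false)|].
move=> phi tphi; split.
- exact: (ip_pd cf (dbf true) (cdf true) tphi).
- exact: (ip_pd cf (dbf false) (cdf false) tphi).
Qed.

Lemma is_weak_grad_addc w gw (c : R) : L2 Omega w ->
  is_weak_grad Omega w gw -> is_weak_grad Omega (fun x => w x + c) gw.
Proof.
move=> wL [g1 g2 wg]; split => // phi tphi.
have add b : ip Omega (fun x => w x + c) (pd b phi) = ip Omega w (pd b phi).
  rewrite ip_addcl ?ip_cst_pd ?mulr0 ?addr0//.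
  exact/test_fun_L2/test_fun_pd.
have [w1 w2] := wg _ tphi.
by rewrite -w1 -w2; split; [exact: (add true)|exact: (add false)].
Qed.

Lemma H1_smooth f : smooth f -> H1 Omega f.
Proof.
move=> sf; split; first exact/L2_continuous/smooth_continuous.
by exists (grad f); exact: is_weak_grad_smooth.
Qed.

Lemma H1_addc w (c : R) : H1 Omega w -> H1 Omega (fun x => w x + c).
Proof.
move=> [wL [gw wgw]]; split; last by exists gw; exact: is_weak_grad_addc.
have -> : (fun x => w x + c) = (fun x => 1 * w x + (fun=> c) x).
  by apply/funext => x; rewrite mul1r.
by apply: L2_lin => //; apply: L2_continuous => x; exact: cvg_cst.
Qed.

Lemma ip_self_ge0 f : 0 <= ip Omega f f.
Proof. exact: inner_ge0. Qed.

Lemma H1_cvg_smooth f : smooth f -> H1_cvg Omega (fun=> f) f.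
Proof.
move=> sf; exists (grad f); first exact: is_weak_grad_smooth.
rewrite [X in X @ _](_ : _ = cst 0); first exact: cvg_cst.
have ip0 (u : R * R -> R) : (forall x, u x = 0) -> ip Omega u u = 0.
  move=> u0; rewrite /ip (@eq_Rintegral _ _ _ _ _ (fun=> 0)) ?Rintegral_cst ?mul0r//.
  by move=> x _; rewrite u0 mulr0.
apply/funext => n; rewrite /ip_grad !ip0 ?addr0// => x /=; exact: subrr.
Qed.

Lemma test_fun_H10 phi : test_fun Omega phi -> H10 Omega phi.
Proof.
move=> tphi; have [sphi _] := tphi; split; first exact: H1_smooth.
by exists (fun=> phi) => //; exact: H1_cvg_smooth.
Qed.

(** The form in which density of test functions is used: weak limits of the approximations and of
    their first partials. The first partial suffices for an argument that integrates against the
    coordinate x_1. *)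
Lemma H10P w : H10 Omega w -> exists (phi : nat -> R * R -> R) gw,
  [/\ forall n, test_fun Omega (phi n), is_weak_grad Omega w gw,
   forall f, L2 Omega f -> (fun n => ip Omega (phi n) f) @ \oo --> ip Omega w f &
   forall f, L2 Omega f -> (fun n => ip Omega (d1 (phi n)) f) @ \oo -->
     ip Omega (fun x => (gw x).1) f].
Proof.
move=> [[wL _] [phi tphi [gw wgw cphi]]]; exists phi, gw.
have [gw1 _ _] := wgw.
(* Each squared L^2 distance is squeezed between 0 and the squared H^1 distance. *)
have sub (u v : nat -> R) : (forall n, 0 <= u n <= v n) ->
    v @ \oo --> (0 : R) -> u @ \oo --> (0 : R).
  move=> uv v0; apply: (@squeeze_cvgr _ _ _ _ (cst 0) v) => //.
  - exact: nearW.
  - exact: cvg_cst.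
split => // f fL; apply: cvg_ip => //.
- by move=> n; exact: test_fun_L2.
- apply: sub cphi => n; rewrite ip_self_ge0/= lerDl.
  by apply: addr_ge0; exact: ip_self_ge0.
- by move=> n; exact/test_fun_L2/(test_fun_pd true).
- apply: sub cphi => n; rewrite ip_self_ge0/= addrCA lerDl.
  by apply: addr_ge0; exact: ip_self_ge0.
Qed.

End Domain.

(** * Constants and H^1_0, and traces on the polygon *)

Section Boundary.
Context {R : realType}.
Variables (Omega : set (R * R)) (loops : seq (seq (R * R))).
Hypothesis hO : polygonal_domain Omega loops.
Implicit Types (f w v phi psi chi g t : R * R -> R) (gw : R * R -> R * R).

Let oO : open Omega := poly_open hO.
Let bO : bounded_set Omega := poly_bounded hO.
Let mO : measurable Omega := open_measurable_prod oO.

(** The integral is the area of [Omega]: finite by boundedness, positive because a nonempty open set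
    contains a square. *)
Lemma ip_one_gt0 : 0 < ip Omega (fun=> 1) (fun=> 1).
Proof.
have -> : ip Omega (fun=> 1) (fun=> 1) = fine (area Omega).
  by rewrite /ip (@eq_Rintegral _ _ _ _ _ (fun=> 1)) ?Rintegral_cst ?mul1r.
apply: fine_gt0; rewrite area_bounded// andbT.
have [x Ox] := poly_nonempty hO.
have /nbhs_ballP[e /= e0 xeO] := open_nbhs_nbhs (conj oO Ox).
have mB (z : R) : measurable (ball z e) by exact: measurable_ball.
apply: (@lt_le_trans _ _ (area (ball x.1 e `*` ball x.2 e))).
  have -> : area (ball x.1 e `*` ball x.2 e) =
      (lebesgue_measure (ball x.1 e) * lebesgue_measure (ball x.2 e))%E.
    by apply: product_measure1E; exact: mB.
  by rewrite !lebesgue_measure_ball ?ltW// -EFinM lte_fin mulr_gt0// pmulrn_lgt0.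
apply: le_measure; rewrite ?inE//; first by apply: measurableX; exact: mB.
Qed.

(* Let D be the difference of the first partials of chi + c and chi obtained as
   limits of test functions.  Both have the same pairing with test functions, so
   D is orthogonal to these; being an L^2 limit of test functions, D vanishes. *)
Lemma H10_addc_notin chi (c : R) : c != 0 -> H10 Omega chi ->
  ~ H10 Omega (fun x => chi x + c).
Proof.
move=> c_neq0 chi0 chi1; have chiL : L2 Omega chi by case: chi0 => -[].
have [phi [gw [tphi wgw cphi cdphi]]] := H10P oO bO chi0.
have [phi' [gw' [tphi' wgw' cphi' cdphi']]] := H10P oO bO chi1.
have cfst : continuous (fst : R * R -> R) by move=> x; exact: cvg_fst.
have fstL : L2 Omega fst by exact: L2_continuous.
have oneL : L2 Omega (fun=> 1) by apply: L2_continuous => // x; exact: cvg_cst.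
have quot x : (fun k : R => k^-1 *:
    (((fst : R * R -> R) \o shift x) (k *: dir true) - x.1)) @ 0^' --> (1 : R).
  apply: cvg_near_cst; near=> k.
  rewrite /= addrK scalerA mulVf ?scale1r//.
  by near: k; exact: nbhs_dnbhs_neq.
have dfst x : derivable (fst : R * R -> R) x (dir true).
  by apply/cvg_ex; exists 1; exact: quot.
have d1fst : pd true fst = (fun=> 1) :> (R * R -> R).
  by apply/funext => x; apply: cvg_lim => //; exact: quot.
have d1L psi : test_fun Omega psi -> L2 Omega (d1 psi).
  by move=> /(test_fun_pd true)/(test_fun_L2 oO bO).
(* Integration by parts against x_1, whose first partial is 1. *)
have fst_d1 psi : test_fun Omega psi ->
    ip Omega (d1 psi) fst = - ip Omega psi (fun=> 1).
  have cd1 : continuous (pd true (fst : R * R -> R)).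
    by rewrite d1fst => x; exact: cvg_cst.
  move=> tpsi; rewrite (ip_sym _ (d1 psi)) (ip_sym _ psi) -d1fst.
  exact: (ip_pd oO bO cfst dfst cd1 tpsi).
(* The same identity for limits of test functions. *)
have fst_gw w gw0 (phi0 : nat -> R * R -> R) :
    (forall n, test_fun Omega (phi0 n)) ->
    (fun n => ip Omega (phi0 n) (fun=> 1)) @ \oo --> ip Omega w (fun=> 1) ->
    (fun n => ip Omega (d1 (phi0 n)) fst) @ \oo -->
      ip Omega (fun x => (gw0 x).1) fst ->
    ip Omega (fun x => (gw0 x).1) fst = - ip Omega w (fun=> 1).
  move=> tphi0 c1 c2; apply: (cvg_unique _ c2) => //.
  have -> : (fun n => ip Omega (d1 (phi0 n)) fst) =
      (fun n => - ip Omega (phi0 n) (fun=> 1)).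
    by apply/funext => n; exact: fst_d1.
  exact: cvgN.
have e1 := fst_gw _ _ _ tphi (cphi _ oneL) (cdphi _ fstL).
have e2 := fst_gw _ _ _ tphi' (cphi' _ oneL) (cdphi' _ fstL).
have [gL _ wgwP] := wgw; have [gL' _ wgwP'] := wgw'.
pose D x := -1 * (gw x).1 + (gw' x).1.
have DL : L2 Omega D by exact: L2_lin.
have DE f : L2 Omega f -> ip Omega D f =
    ip Omega (fun x => (gw' x).1) f - ip Omega (fun x => (gw x).1) f.
  by move=> fL; rewrite /D ip_lin// mulN1r addrC.
(* The weak gradients of [chi] and [chi + c] pair equally with test functions, since [c] pairs to 0
   with their derivatives; [d1 psi] is again a test function. *)
have Dtest psi : test_fun Omega psi -> ip Omega (d1 psi) D = 0.
  have perp phi0 : test_fun Omega phi0 -> ip Omega D phi0 = 0.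
    move=> tphi0; rewrite DE; last exact: test_fun_L2.
    have [h1 _] := wgwP _ tphi0; have [h2 _] := wgwP' _ tphi0.
    have c_d1 : ip Omega (fun=> 1) (d1 phi0) = 0.
      exact: (ip_cst_pd oO bO true 1 tphi0).
    move: h2; rewrite (ip_addcl oO bO)//; last exact: d1L.
    rewrite c_d1 mulr0 addr0 h1; lra.
  by move=> /(test_fun_pd true) ?; rewrite ip_sym; exact: perp.
have perp gw0 (phi0 : nat -> R * R -> R) :
    (forall n, test_fun Omega (phi0 n)) ->
    (fun n => ip Omega (d1 (phi0 n)) D) @ \oo -->
      ip Omega (fun x => (gw0 x).1) D ->
    ip Omega (fun x => (gw0 x).1) D = 0.
  move=> tphi0 cv; apply: (cvg_unique _ cv) => //.
  have -> : (fun n => ip Omega (d1 (phi0 n)) D) = (fun=> 0).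
    by apply/funext => n; exact: Dtest.
  exact: cvg_cst.
have DD : ip Omega D D = 0.
  rewrite DE// (perp _ _ tphi (cdphi _ DL)) (perp _ _ tphi' (cdphi' _ DL)).
  exact: subrr.
(* Cauchy-Schwarz replaces the almost everywhere vanishing of [D]. *)
have : ip Omega D fst = 0.
  apply/eqP; rewrite -sqrf_eq0 eq_le sqr_ge0 andbT.
  by have := ip_CS oO DL fstL; rewrite DD mul0r.
(* The same pairing equals [- c] times the area of [Omega], which is not 0. *)
rewrite DE// e1 e2 (ip_addcl oO bO)// opprD addrAC subrr add0r => /eqP.
by rewrite oppr_eq0 mulf_eq0 (negbTE c_neq0)/= gt_eqF// ip_one_gt0.
Unshelve. all: by end_near. Qed.

Lemma edge_notin e s : e \in edges loops -> `[0, 1]%classic s ->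
  ~ Omega (edge_param e s).
Proof.
move=> eE s01; have : (closure Omega `\` Omega) (edge_param e s).
  by rewrite (poly_boundary hO); exists e => //; exists s.
by case.
Qed.

(** The test functions approximating [psi] serve in [is_trace] too: they vanish on every edge, as
    their supports lie in [Omega], which is disjoint from the edges. *)
Lemma H10_trace0 psi : H10 Omega psi -> is_trace Omega loops psi (fun=> 0).
Proof.
move=> [psi1 [phi tphi cphi]]; split => //.
  move=> e eE; split; first exact: measurable_cst.
  by apply: eq_integrable (integrable0 _ _) => // x _ /=; rewrite expr0n.
exists phi; first by move=> n; case: (tphi n).
split => //.
rewrite [X in X @ _](_ : _ = cst 0); first exact: cvg_cst.
apply/funext => n; rewrite /ip_bd big1_seq// => e /andP[_ eE].
rewrite (@eq_Rintegral _ _ _ _ _ (fun=> 0)) ?Rintegral_cst ?mul0r ?mulr0// => s.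
rewrite inE => s01 /=; have [_ [K [_ KO phi0]]] := tphi n.
by rewrite phi0 ?subr0 ?mulr0// => /KO; exact: edge_notin.
Qed.

Lemma L2_bd_cst (c : R) : L2_bd loops (fun=> c).
Proof.
move=> e eE; split; first exact: measurable_cst.
have : lebesgue_measure.-integrable (`[0, 1]%classic : set R)
    (EFin \o (cst (c ^+ 2))).
  apply: continuous_compact_integrable; first exact: segment_compact.
  by apply: continuous_subspaceT => x; exact: cvg_cst.
exact.
Qed.

Lemma L2_bd_addc t (c : R) : L2_bd loops t -> L2_bd loops (fun x => t x + c).
Proof.
move=> tL; have -> : (fun x => t x + c) = (fun x => 1 * t x + (fun=> c) x).
  by apply/funext => x; rewrite mul1r.
move=> e eE.
have m01 : measurable (`[0, 1]%classic : set R) by exact: measurable_itv.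
exact: (square_integrable_lin (mu := lebesgue_measure) m01 1 (tL e eE)
  (L2_bd_cst c eE)).
Qed.

Lemma ip_bd_addc g t (c : R) : L2_bd loops g -> L2_bd loops t ->
  ip_bd loops g (fun x => t x + c) = ip_bd loops g t + ip_bd loops g (fun=> c).
Proof.
move=> gL tL; rewrite /ip_bd -big_split/=; apply: eq_big_seq => e eE.
have m01 : measurable (`[0, 1]%classic : set R) by exact: measurable_itv.
rewrite -mulrDr; congr (_ * _).
rewrite -RintegralD//.
- by apply: eq_Rintegral => x _; rewrite mulrDr.
- exact: (square_integrable_mul (mu := lebesgue_measure) m01
    (gL e eE) (tL e eE)).
- exact: (square_integrable_mul (mu := lebesgue_measure) m01
    (gL e eE) (L2_bd_cst c eE)).
Qed.

(** Shifting the approximating sequence by [c] as well leaves all differences and gradients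
    unchanged. *)
Lemma is_trace_addc chi t (c : R) : is_trace Omega loops chi t ->
  is_trace Omega loops (fun x => chi x + c) (fun x => t x + c).
Proof.
move=> [chi1 tL [phi sphi [[gw wgw cphi] ct]]]; split.
- exact: (H1_addc oO bO).
- exact: L2_bd_addc.
exists (fun n x => phi n x + c); first by move=> n; exact: smooth_addc.
have subE f g : (fun x => f x + c) \- (fun x => g x + c) = f \- g.
  by apply/funext => x /=; ring.
split.
  exists gw; first by apply: (is_weak_grad_addc oO bO) => //; case: chi1.
  apply: cvg_trans cphi; apply: near_eq_cvg; apply: nearW => n.
  by rewrite subE grad_addc.
apply: cvg_trans ct; apply: near_eq_cvg; apply: nearW => n.
by rewrite subE.
Qed.

End Boundary.

(** * From each pair of equations to the other *)

Section Equivalence.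
Context {R : realType}.
Variables (Omega : set (R * R)) (loops : seq (seq (R * R))).
Hypothesis hO : polygonal_domain Omega loops.
Implicit Types (v phi psi zeta l g : R * R -> R).

Let oO : open Omega := poly_open hO.
Let bO : bounded_set Omega := poly_bounded hO.

Lemma berggren_state_laplacian phi v : L2 Omega phi -> H1 Omega v ->
  berggren_state Omega phi v -> is_laplacian Omega v (fun x => - phi x).
Proof.
move=> phiL [vL [gv wgv]] st; split; first exact: L2_opp.
move=> psi tpsi; have psiL := test_fun_L2 oO bO tpsi.
have [_ _ gvP] := wgv.
have t1 := test_fun_pd true tpsi; have t2 := test_fun_pd false tpsi.
have L11 := test_fun_L2 oO bO (test_fun_pd true t1).
have L22 := test_fun_L2 oO bO (test_fun_pd false t2).
(* The weak gradient of [v] is tested with the first partials of [psi], which produces the two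
   second partials of the Laplacian. *)
have [e1 _] := gvP _ t1; have [_ e2] := gvP _ t2.
have := st gv psi (grad psi) wgv (test_fun_H10 oO bO tpsi)
  (is_weak_grad_smooth oO bO tpsi.1).
rewrite (ip_opp oO)// => <-.
have -> : laplace psi = (fun x => 1 * d1 (pd true psi) x + d2 (pd false psi) x).
  by apply/funext => x; rewrite mul1r.
apply: (etrans (ip_sym _ _ _)); apply: (etrans (ip_lin oO 1 L11 L22 vL)).
have {}e1 := etrans (ip_sym _ _ _) e1; have {}e2 := etrans (ip_sym _ _ _) e2.
apply: (etrans (congr2 (fun a b => 1 * a + b) e1 e2)).
rewrite mul1r -opprD; reflexivity.
Qed.

Lemma berggren_flux_normal_derivative phi v zeta : L2 Omega phi ->
  L2_bd loops zeta -> berggren_flux Omega loops phi v zeta ->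
  is_normal_derivative Omega loops v (fun x => - phi x) zeta.
Proof.
move=> phiL zetaL fl; split => // gv chi gchi t wgv chi1 wgchi tr.
have chiL : L2 Omega chi by case: chi1.
have tL : L2_bd loops t by case: tr.
rewrite (ip_opp oO)//.
have [chi0|chi0] := pselect (H10 Omega chi); last exact: fl.
(* The flux equation for [chi + c], which has the same weak gradient as [chi] and trace [t + c]. *)
have flc (c : R) : c != 0 -> ip_bd loops zeta t + ip_bd loops zeta (fun=> c) =
    ip_grad Omega gv gchi - (ip Omega phi chi + c * ip Omega (fun=> 1) phi).
  move=> c0; rewrite -ip_bd_addc// (ip_sym _ _ chi) -(ip_addcl oO bO)// ip_sym.
  apply: fl => //.
  - split; [exact: (H1_addc oO bO)|exact: (H10_addc_notin hO)].
  - exact: (is_weak_grad_addc oO bO).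
  - exact: (is_trace_addc hO).
(* Twice the equation for [c = 1] minus that for [c = 1 + 1] cancels every term in [c], the boundary
   term being additive by [e3]; the equation for [chi] itself remains. *)
have e1 := flc 1 (oner_neq0 _).
have e2 := flc (1 + 1) (lt0r_neq0 (addr_gt0 ltr01 ltr01)).
have e3 := ip_bd_addc 1 zetaL (L2_bd_cst (loops := loops) (1 : R)).
rewrite /= in e3; rewrite e3 in e2; lra.
Qed.

(** In Green's formula with a test function of zero trace the boundary term drops out. *)
Lemma normal_derivative_berggren_state v l g : L2 Omega l ->
  is_normal_derivative Omega loops v l g ->
  berggren_state Omega (fun x => - l x) v.
Proof.
move=> lL [gL nd] gv psi gpsi wgv psi0 wgpsi; have [psi1 _] := psi0.
have := nd gv psi gpsi _ wgv psi1 wgpsi (H10_trace0 hO psi0).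
rewrite (ip_opp oO)//; last by case: psi1.
rewrite /ip_bd big1 => [/esym/eqP|e _]; first by rewrite addr_eq0 => /eqP.
rewrite (@eq_Rintegral _ _ _ _ _ (fun=> 0)) ?Rintegral_cst ?mul0r ?mulr0// => s _.
by rewrite mulr0.
Qed.

End Equivalence.

Theorem lemma2p9 (R : realType) (Omega : set (R * R))
    (loops : seq (seq (R * R)))
    (hOmega : polygonal_domain Omega loops)
    (hcorner : at_most_one_nonconvex_corner Omega loops)
    (f u : (R * R -> R) -> R)
    (hf : in_dual (V Omega) (normV Omega) f)
    (hu : in_dual (VGamma Omega loops) (normVGamma Omega loops) u)
    (y : R * R -> R) (hy : L2 Omega y) :
  very_weak_formulation Omega loops f u y <->
  berggren_formulation Omega loops f u y.
Proof.
have oO := poly_open hOmega.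
split=> [vw phi v zeta phiL Vv [w [k [_ _ [zetaL _]]]] st fl
        |bg v l g Vv lap nd].
(* The very weak formulation is applied with Laplacian [- phi] and normal derivative [zeta]. *)
- have [[v1 _] _] := Vv.
  have := vw v _ zeta Vv (berggren_state_laplacian hOmega phiL v1 st)
    (berggren_flux_normal_derivative hOmega phiL zetaL fl).
  by rewrite ip_sym (ip_opp oO)// ip_sym; lra.
(* Berggren's formulation is applied with [phi] = [- l] and [zeta] = [g]; its flux equation is
   Green's formula for [g], restricted to [chi] outside H^1_0. *)
- have lL : L2 Omega l by case: lap.
  have := bg (fun x => - l x) v g (L2_opp oO lL) Vv.
  rewrite ip_sym (ip_opp oO)// ip_sym => e; apply: oppr_inj.
  rewrite opprB addrC; apply: e.
  - by exists v, l.
  - exact: normal_derivative_berggren_state nd.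
  - move=> gv chi gchi t wgv [chi1 _] wgchi tr.
    by rewrite (ip_opp oO) ?opprK//; [exact: nd.2 tr|case: chi1].
Qed.
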